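(* Let $\rho$ be a left-linear constrained rewrite rule and let $\Pi X.\,s\,[\exists\vec{x}.\varphi]$ be a satisfiable existentially constrained term such that $\mathrm{Var}(\rho)\cap\mathrm{Var}(s,\varphi)=\emptyset$. If $\Pi X.\,s\,[\exists\vec{x}.\varphi]\to_\rho \Pi Y.\,t\,[\exists\vec{y}.\psi]$ (a most general rewrite step), then $\Pi Y.\,t\,[\exists\vec{y}.\psi]$ is a satisfiable existentially constrained term.
   Context: Fix a many-sorted signature whose sorts are partitioned into theory sorts and term sorts and whose function symbols are partitioned into theory symbols (all argument and result sorts are theory sorts) and term symbols; there is a theory sort $\mathsf{Bool}$. Terms are built from function symbols and sorted variables; $\mathrm{Var}(t_1,\dots,t_n)$ is the set of variables occurring in the $t_i$; $\mathrm{Pos}(s)$ is the set of positions of $s$, $s|_p$ the subterm at $p$, $s[u]_p$ the replacement of $s|_p$ by $u$. A fixed model $\mathcal{M}$ interprets each theory sort by a nonempty set and each theory symbol by a function; $\mathsf{Bool}$ is interpreted as $\{\mathsf{true},\mathsf{false}\}$ and the usual connectives $\neg,\land,\Rightarrow,\Leftrightarrow$ and equalities $=$ are available with standard meaning. Every element of every interpreted theory sort is a constant theory symbol, called a value; $\mathrm{Val}$ is the set of values. A logical constraint is a term of sort $\mathsf{Bool}$ built from theory symbols and variables. For a valuation $\xi$ (a sort-respecting assignment of model elements to variables), $\models_{\mathcal{M},\xi}\varphi$ means $\varphi$ evaluates to true; $\models_{\mathcal{M}}\varphi$ means this holds for all $\xi$. A substitution $\sigma$ is a sort-preserving map from variables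 to terms, extended homomorphically; $\mathrm{Dom}(\sigma)=\{x\mid \sigma(x)\neq x\}$; $\sigma$ is $X$-valued if $\sigma(X)\subseteq\mathrm{Val}$. An existential constraint $\exists\vec{x}.\varphi$ consists of a sequence of variables $\vec{x}$ and a logical constraint $\varphi$ with $\{\vec{x}\}\subseteq\mathrm{Var}(\varphi)$; $\mathrm{FVar}(\exists\vec{x}.\varphi)=\mathrm{Var}(\varphi)\setminus\{\vec{x}\}$ and $\mathrm{BVar}(\exists\vec{x}.\varphi)=\{\vec{x}\}$. $\models_{\mathcal{M},\xi}\exists\vec{x}.\varphi$ iff there are values $\vec{v}$ with $\models_{\mathcal{M},\xi}\varphi\{\vec{x}\mapsto\vec{v}\}$; it is valid if this holds for every $\xi$, satisfiable if for some $\xi$; combinations such as $(\exists\vec x.\varphi)\Rightarrow(\exists\vec z.\pi)$ are evaluated accordingly. An existentially constrained term $\Pi X.\,s\,[\exists\vec{x}.\varphi]$ is a triple of a set of variables $X$, a term $s$ and an existential constraint $\exists\vec{x}.\varphi$ such that $\mathrm{FVar}(\exists\vec{x}.\varphi)\subseteq X\subseteq\mathrm{Var}(s)$ and $\{\vec{x}\}\cap\mathrm{Var}(s)=\emptyset$; it is satisfiable if $\exists\vec{x}.\varphi$ is satisfiable. A constrained rewrite rule $\rho:\Pi Z.\,\ell\to r\,[\pi]$ consists of terms $\ell,r$ of the same sort, a logical constraint $\pi$ and a set of variables $Z$ with $(\mathrm{Var}(r)\setminus\mathrm{Var}(\ell))\cup\mathrm{Var}(\pi)\subseteq Z\subseteq\mathrm{Var}(\ell,r,\pi)$;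 $\mathrm{Var}(\rho)=\mathrm{Var}(\ell,r,\pi)$; $\rho$ is left-linear if $\ell$ is linear; $\mathrm{ExVar}(\rho)=\mathrm{Var}(r)\setminus\mathrm{Var}(\ell)$. Let $\Pi X.s[\exists\vec{x}.\varphi]$ be satisfiable and $\rho$ left-linear with $\mathrm{Var}(\rho)\cap\mathrm{Var}(s,\varphi)=\emptyset$. The term has a $\rho$-redex at $p\in\mathrm{Pos}(s)$ using $\gamma$ if (1) $\mathrm{Dom}(\gamma)=\mathrm{Var}(\ell)$, (2) $s|_p=\ell\gamma$, (3) $\gamma(x)\in\mathrm{Val}\cup X$ for all $x\in\mathrm{Var}(\ell)\cap Z$, (4) $\models_{\mathcal{M}}(\exists\vec{x}.\varphi)\Rightarrow(\exists\vec{z}.\pi\gamma)$ where $\{\vec{z}\}=\mathrm{Var}(\pi)\setminus\mathrm{Var}(\ell)$. Then there is a most general rewrite step $\Pi X.s[\exists\vec{x}.\varphi]\to^p_{\rho,\gamma}\Pi Y.t[\exists\vec{y}.\psi]$ (also written $\to_\rho$), where $t=s[r\gamma]_p$, $\psi=\varphi\land\pi\gamma$, $\{\vec{y}\}=\mathrm{Var}(\psi)\setminus\mathrm{Var}(t)$, and $Y=\mathrm{ExVar}(\rho)\cup(X\cap\mathrm{Var}(t))$. *)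

(* Defs.v *)
From HB Require Import structures.
From mathcomp Require Import all_boot.
From mathcomp Require Import finmap.

Set Implicit Arguments.
Unset Strict Implicit.
Unset Printing Implicit Defensive.

Local Open Scope fset_scope.

(* The sorted variables are part of the signature. [theory_sort] and
   [theory_fun] are the two partitions: the sorts (resp. function symbols)
   outside them are the term sorts (resp. term symbols). *)
Record signature := Signature {
  sort : eqType;
  theory_sort : pred sort;
  bool_sort : sort;
  bool_sort_theory : theory_sort bool_sort;
  var : choiceType;
  var_sort : var -> sort;
  fsym : Type;
  fdom : fsym -> seq sort;
  fcod : fsym -> sort;
  theory_fun : pred fsym;
  theory_fun_sorts : forall f,
    theory_fun f -> all theory_sort (fdom f) && theory_sort (fcod f)
}.

(* Raw terms; the terms of the many-sorted language are those satisfying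
   [well_sorted] below. *)
Inductive term (S : signature) :=
| Var of var S
| App of fsym S & seq (term S).
Arguments Var {S} x.

Section Terms.
Variable S : signature.
Implicit Types (t u : term S) (x : var S) (s : seq (var S)).

Definition sort_of t : sort S :=
  match t with Var x => var_sort x | App f _ => fcod f end.

Fixpoint well_sorted t : bool :=
  match t with
  | Var _ => true
  | App f ts => (map sort_of ts == fdom f) && all well_sorted ts
  end.

(* The variable occurrences of a term, from left to right. *)
Fixpoint var_occs t : seq (var S) :=
  match t with Var x => [:: x] | App _ ts => flatten (map var_occs ts) end.

Definition vars t : {fset var S} := [fset x in var_occs t].

Definition linear t : bool := uniq (var_occs t).

Fixpoint theory_term t : bool :=
  match t with Var _ => true | App f ts => theory_fun f && all theory_term ts end.

Definition is_constraint t : bool :=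
  [&& well_sorted t, sort_of t == bool_sort S & theory_term t].

(* Positions are sequences of argument indices counted from 0; p is a position
   of t exactly when [subterm_at t p] is not [None], and [replace_at t p u] is
   only meaningful in that case. *)
Fixpoint subterm_at t (p : seq nat) : option (term S) :=
  match p, t with
  | [::], _ => Some t
  | _ :: _, Var _ => None
  | i :: q, App _ ts => obind (fun ti => subterm_at ti q) (onth ts i)
  end.

Fixpoint replace_at t (p : seq nat) u : term S :=
  match p, t with
  | [::], _ => u
  | _ :: _, Var _ => t
  | i :: q, App f ts =>
      App f (set_nth u ts i (replace_at (nth u ts i) q u))
  end.

Fixpoint subst (sigma : var S -> term S) t : term S :=
  match t with
  | Var x => sigma x
  | App f ts => App f (map (subst sigma) ts)
  end.

Definition is_substitution (sigma : var S -> term S) : Prop :=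
  forall x, well_sorted (sigma x) /\ sort_of (sigma x) = var_sort x.

(* The map {xs |-> ts}; it is the identity outside xs. *)
Definition bind s (ts : seq (term S)) : var S -> term S :=
  fun x => nth (Var x) ts (index x s).

Definition has_profile (f : fsym S) (ds : seq (sort S)) (c : sort S) : Prop :=
  [/\ theory_fun f, fdom f = ds & fcod f = c].

End Terms.

(* The interpretation of a theory sort is the set of the elements of [elt]
   tagged with it by [elt_sort]. [interp] is constrained only on theory symbols
   applied to arguments of the right sorts, the only case in which it is used
   to evaluate logical constraints. *)
Record model (S : signature) := Model {
  elt : Type;
  elt_sort : elt -> sort S;
  elt_sort_theory : forall a, theory_sort (elt_sort a);
  elt_nonempty : forall tau : sort S,
    theory_sort tau -> exists a, elt_sort a = tau;
  interp : fsym S -> seq elt -> elt;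
  interp_sort : forall f args,
    theory_fun f -> map elt_sort args = fdom f ->
    elt_sort (interp f args) = fcod f;
  of_bool : bool -> elt;
  of_bool_inj : injective of_bool;
  of_boolP : forall a,
    elt_sort a = bool_sort S <-> exists b, a = of_bool b;
  (* the constant symbol of each element *)
  val_sym : elt -> fsym S;
  val_sym_profile : forall a, has_profile (val_sym a) [::] (elt_sort a);
  val_symE : forall a, interp (val_sym a) [::] = a;
  not_sym : fsym S;
  not_profile : has_profile not_sym [:: bool_sort S] (bool_sort S);
  notE : forall b, interp not_sym [:: of_bool b] = of_bool (~~ b);
  and_sym : fsym S;
  and_profile :
    has_profile and_sym [:: bool_sort S; bool_sort S] (bool_sort S);
  andE : forall b c,
    interp and_sym [:: of_bool b; of_bool c] = of_bool (b && c);
  imp_sym : fsym S;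
  imp_profile :
    has_profile imp_sym [:: bool_sort S; bool_sort S] (bool_sort S);
  impE : forall b c,
    interp imp_sym [:: of_bool b; of_bool c] = of_bool (b ==> c);
  iff_sym : fsym S;
  iff_profile :
    has_profile iff_sym [:: bool_sort S; bool_sort S] (bool_sort S);
  iffE : forall b c,
    interp iff_sym [:: of_bool b; of_bool c] = of_bool (b == c);
  eq_sym : sort S -> fsym S;
  eq_profile : forall tau, theory_sort tau ->
    has_profile (eq_sym tau) [:: tau; tau] (bool_sort S);
  eqE : forall a b, elt_sort a = elt_sort b ->
    (interp (eq_sym (elt_sort a)) [:: a; b] = of_bool true <-> a = b)
}.

(* Pi [lvars]. [body] [exists [bvars]. [cond]] *)
Record ecterm (S : signature) := ECTerm {
  lvars : {fset var S};
  body : term S;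
  bvars : seq (var S);
  cond : term S
}.

(* Pi [rvars]. [lhs] -> [rhs] [ [guard] ] *)
Record rule (S : signature) := Rule {
  rvars : {fset var S};
  lhs : term S;
  rhs : term S;
  guard : term S
}.

Section Semantics.
Variables (S : signature) (M : model S).
Implicit Types (phi t : term S) (xs : seq (var S)).

Definition value_term (a : elt M) : term S := App (val_sym a) [::].

Definition is_value t : Prop := exists a : elt M, t = value_term a.

(* What xi does on variables of term sorts is irrelevant: they do not occur in
   logical constraints. *)
Definition is_valuation (xi : var S -> elt M) : Prop :=
  forall x, theory_sort (var_sort x) -> elt_sort (xi x) = var_sort x.

Fixpoint eval (xi : var S -> elt M) t : elt M :=
  match t with
  | Var x => xi x
  | App f ts => interp f (map (eval xi) ts)
  end.

Definition holds (xi : var S -> elt M) phi : Prop :=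
  eval xi phi = of_bool M true.

Definition ex_holds (xi : var S -> elt M) xs phi : Prop :=
  exists vs : seq (elt M),
    [/\ size vs = size xs,
        is_substitution (bind xs (map value_term vs))
      & holds xi (subst (bind xs (map value_term vs)) phi)].

Definition ex_satisfiable xs phi : Prop :=
  exists xi, is_valuation xi /\ ex_holds xi xs phi.

Definition ex_entails xs phi zs pi : Prop :=
  forall xi, is_valuation xi -> ex_holds xi xs phi -> ex_holds xi zs pi.

Definition conj phi pi : term S := App (and_sym M) [:: phi; pi].

End Semantics.

Section Rewriting.
Variable S : signature.
Implicit Types (T : ecterm S) (rho : rule S).

Definition is_ex_constraint (xs : seq (var S)) (phi : term S) : Prop :=
  is_constraint phi /\ [fset x in xs] `<=` vars phi.

Definition ex_fvars (xs : seq (var S)) (phi : term S) : {fset var S} :=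
  vars phi `\` [fset x in xs].

Definition is_ecterm T : Prop :=
  [/\ well_sorted (body T),
      is_ex_constraint (bvars T) (cond T),
      ex_fvars (bvars T) (cond T) `<=` lvars T,
      lvars T `<=` vars (body T)
    & [fset x in bvars T] `&` vars (body T) = fset0].

Definition ec_satisfiable (M : model S) T : Prop :=
  ex_satisfiable M (bvars T) (cond T).

Definition rule_vars rho : {fset var S} :=
  vars (lhs rho) `|` vars (rhs rho) `|` vars (guard rho).

Definition ex_vars rho : {fset var S} := vars (rhs rho) `\` vars (lhs rho).

Definition is_rule rho : Prop :=
  [/\ well_sorted (lhs rho) /\ well_sorted (rhs rho),
      sort_of (lhs rho) = sort_of (rhs rho),
      is_constraint (guard rho),
      ex_vars rho `|` vars (guard rho) `<=` rvars rho
    & rvars rho `<=` rule_vars rho].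

Definition left_linear rho : Prop := linear (lhs rho).

Definition has_redex (M : model S) rho T (p : seq nat)
    (gamma : var S -> term S) : Prop :=
  [/\ is_substitution gamma,
      forall x, gamma x <> Var x <-> x \in vars (lhs rho),
      subterm_at (body T) p = Some (subst gamma (lhs rho)),
      forall x, x \in vars (lhs rho) `&` rvars rho ->
        is_value M (gamma x) \/ exists2 y, y \in lvars T & gamma x = Var y
    & exists zs : seq (var S),
        [fset z in zs] = vars (guard rho) `\` vars (lhs rho) /\
        ex_entails M (bvars T) (cond T) zs (subst gamma (guard rho))].

(* The order of the bound variables of T' is left open. *)
Definition mg_step_at (M : model S) rho (p : seq nat)
    (gamma : var S -> term S) T T' : Prop :=
  [/\ has_redex M rho T p gamma,
      body T' = replace_at (body T) p (subst gamma (rhs rho)),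
      cond T' = conj M (cond T) (subst gamma (guard rho)),
      [fset y in bvars T'] = vars (cond T') `\` vars (body T')
    & lvars T' = ex_vars rho `|` (lvars T `&` vars (body T'))].

Definition mg_step (M : model S) rho T T' : Prop :=
  exists p gamma, mg_step_at M rho p gamma T T'.

End Rewriting.

(* Main.v *)
Require Import Defs.
From mathcomp Require Import all_boot finmap.
From Stdlib Require List.

(** A model of the new constraint is glued from two models: one of the old
    constraint, and the one that condition (4) of the redex provides for the
    instantiated guard over the same free variables. The bound variables of
    the former do not occur in [s], the fresh variables of the latter occur
    only in the rule, and the instantiated guard otherwise contains only
    variables of [X]; so the two models agree wherever both matter. *)

Set Implicit Arguments.
Unset Strict Implicit.
Unset Printing Implicit Defensive.

Local Open Scope fset_scope.

(** * Sorts and variable occurrences under substitution and replacement *)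

Section Terms.
Variable S : signature.
Implicit Types (t u v : term S) (x y : var S) (p : seq nat).
Implicit Types (sigma : var S -> term S).

(** Arguments are nested inside a list; [List.Forall] carries the induction hypotheses for them,
    which the generated principle omits. *)
Lemma term_nested_ind (P : term S -> Prop) :
  (forall x, P (Var x)) ->
  (forall f ts, List.Forall P ts -> P (App f ts)) ->
  forall t, P t.
Proof.
move=> PVar PApp; fix IH 1 => -[x|f ts]; first exact: PVar.
by apply: PApp; elim: ts => [|t ts IHts]; constructor.
Qed.

Lemma mem_vars x t : (x \in vars t) = (x \in var_occs t).
Proof. by rewrite /vars in_fset. Qed.

Lemma sort_of_subst sigma t :
  is_substitution sigma -> sort_of (subst sigma t) = sort_of t.
Proof. by move=> sub; case: t => //= x; case: (sub x). Qed.

Lemma well_sorted_subst sigma t :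
  is_substitution sigma -> well_sorted t -> well_sorted (subst sigma t).
Proof.
move=> sub; elim/term_nested_ind: t => [x _|f ts IH] /=; first by case: (sub x).
case/andP=> /eqP <- ws; apply/andP; split.
  by rewrite -map_comp; apply/eqP/eq_map => t /=; apply: sort_of_subst.
elim: IH ws => //= t us IHt _ IHus /andP[wt wus].
by rewrite IHt // IHus.
Qed.

Lemma theory_term_subst sigma t :
  theory_term t -> {in var_occs t, forall x, theory_term (sigma x)} ->
  theory_term (subst sigma t).
Proof.
elim/term_nested_ind: t => [x _ /(_ x)|f ts IH] /=.
  by rewrite mem_head; apply.
case/andP=> -> /=; elim: IH => //= t us IHt _ IHus /andP[tt tus] th.
rewrite IHt ?IHus //.
- by move=> x xus; apply: th; rewrite mem_cat xus orbT.
- by move=> x xt; apply: th; rewrite mem_cat xt.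
Qed.

(** Theory symbols take only arguments of theory sorts, so the sort condition passes from the root
    down to the leaves; the condition at the root settles a term that is a single variable. *)
Lemma theory_term_var_sort t :
  well_sorted t -> theory_term t -> theory_sort (sort_of t) ->
  {in var_occs t, forall x, theory_sort (var_sort x)}.
Proof.
elim/term_nested_ind: t => [x _ _ /= th y|f ts IH] /=.
  by rewrite mem_seq1 => /eqP ->.
case/andP=> /eqP sts wts /andP[thf tts] _.
have /andP[] := theory_fun_sorts thf; rewrite -{}sts => sts _.
elim: IH wts tts sts => //= t us IHt _ IHus.
move=> /andP[wt wus] /andP[tt tus] /andP[st sus] x.
by rewrite mem_cat => /orP[]; [apply: IHt | apply: IHus].
Qed.

Lemma var_occs_subst sigma t :
  var_occs (subst sigma t) =
  flatten [seq var_occs (sigma x) | x <- var_occs t].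
Proof.
elim/term_nested_ind: t => [x|f ts IH] /=; first by rewrite cats0.
elim: IH => //= t us -> _ ->.
by rewrite map_cat flatten_cat.
Qed.

(** Splitting the argument list around index [i] trades [nth] and [set_nth] for concatenation, so
    that inductions on positions meet no default values. *)
Lemma subterm_at_App f (ts : seq (term S)) i p u :
  subterm_at (App f ts) (i :: p) = Some u ->
  exists ts1 ti ts2, [/\ ts = ts1 ++ ti :: ts2, subterm_at ti p = Some u
    & forall v, replace_at (App f ts) (i :: p) v =
                App f (ts1 ++ replace_at ti p v :: ts2)].
Proof.
move=> /=; elim: ts i => [|t ts IHts] [|i] //= sub.
  by exists [::], t, ts.
have [ts1 [ti [ts2 [-> subti rep]]]] := IHts i sub.
exists (t :: ts1), ti, ts2; split=> // v.
by case: (rep v) => ->.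
Qed.

(** Both conclusions go through one induction: the symbol above a replaced argument stays well
    sorted only if that argument keeps its sort. *)
Lemma replace_at_well_sorted t p u v :
  subterm_at t p = Some u -> well_sorted t -> well_sorted v ->
  sort_of v = sort_of u ->
  well_sorted (replace_at t p v) /\ sort_of (replace_at t p v) = sort_of t.
Proof.
move=> + + wv svu; elim: p t => [|i p IHp] t.
  by case: t => [x|f ts] [tu] _; rewrite /= wv svu -tu.
case: t => [//|f ts] /subterm_at_App[ts1 [ti [ts2 [-> subti ->]]]] /=.
rewrite !map_cat !all_cat /= => /and4P[/eqP <- w1 wti w2].
have [-> ->] := IHp ti subti wti.
by rewrite w1 w2 eqxx.
Qed.

Lemma var_occs_subterm_at t p u :
  subterm_at t p = Some u -> {subset var_occs u <= var_occs t}.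
Proof.
elim: p t => [|i p IHp] t; first by case: t => [x|f ts] /= [<-].
case: t => [//|f ts] /subterm_at_App[ts1 [ti [ts2 [-> subti _]]]] x /= xu.
by rewrite map_cat flatten_cat /= !mem_cat (IHp ti subti x xu) orbT.
Qed.

Lemma var_occs_replace_at t p u v x :
  subterm_at t p = Some u -> x \in var_occs (replace_at t p v) ->
  (x \in var_occs t) || (x \in var_occs v).
Proof.
elim: p t => [|i p IHp] t; first by case: t => [y|f ts] _ /= ->; rewrite orbT.
case: t => [//|f ts] /subterm_at_App[ts1 [ti [ts2 [-> subti ->]]]] /=.
rewrite !map_cat !flatten_cat /= !mem_cat => /or3P[->|/(IHp ti subti)|->] //.
- by case/orP=> ->; rewrite ?orbT.
- by rewrite !orbT.
Qed.

Lemma var_occs_replacement t p u v :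
  subterm_at t p = Some u ->
  {subset var_occs v <= var_occs (replace_at t p v)}.
Proof.
elim: p t => [|i p IHp] t; first by case: t => [y|f ts] _ x.
case: t => [//|f ts] /subterm_at_App[ts1 [ti [ts2 [_ subti ->]]]] x /= xv.
by rewrite map_cat flatten_cat /= !mem_cat (IHp ti subti x xv) orbT.
Qed.

End Terms.

(** * Existential constraints expressed through valuations *)

Section Semantics.
Variables (S : signature) (M : model S).
Implicit Types (t phi : term S) (xs : seq (var S)) (xi : var S -> elt M).

Lemma eval_subst xi (sigma : var S -> term S) t :
  eval xi (subst sigma t) = eval (fun x => eval xi (sigma x)) t.
Proof.
elim/term_nested_ind: t => [//|f ts IH] /=; congr (interp f _).
by elim: IH => //= t us -> _ ->.
Qed.

Lemma eq_in_eval xi1 xi2 t :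
  {in var_occs t, xi1 =1 xi2} -> eval xi1 t = eval xi2 t.
Proof.
elim/term_nested_ind: t => [x|f ts IH] /= eqxi; first exact/eqxi/mem_head.
congr (interp f _); elim: IH eqxi => //= t us IHt _ IHus eqxi.
rewrite IHt ?IHus // => x xin; apply: eqxi; rewrite mem_cat xin ?orbT //.
Qed.

Lemma eval_value_term xi (a : elt M) : eval xi (value_term a) = a.
Proof. exact: val_symE. Qed.

Lemma bind_notin xs (ts : seq (term S)) x :
  size ts = size xs -> x \notin xs -> bind xs ts x = Var x.
Proof.
(* The index of an absent variable is the length of [xs], where [nth] returns its default
   [Var x]. *)
by move=> eqs xxs; rewrite /bind memNindex // -eqs nth_default.
Qed.

Lemma bind_value_term xs (vs : seq (elt M)) x :
  size vs = size xs -> x \in xs ->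
  exists a : elt M, bind xs (map (@value_term S M) vs) x = value_term a.
Proof.
(* As [x] lies in [xs], [vs] is nonempty, and its head supplies the default element that [nth]
   needs. *)
case: vs => [|v vs] eqs xxs; first by case: xs eqs xxs.
exists (nth v (v :: vs) (index x xs)).
by rewrite /bind (nth_map v) // eqs index_mem.
Qed.

(** The values substituted for the bound variables are moved into the valuation; they have the right
    sorts because the substitution preserves sorts. *)
Lemma ex_holds_valuation xi xs phi :
  is_valuation xi -> ex_holds xi xs phi ->
  exists xi', [/\ is_valuation xi', holds xi' phi
    & forall x, x \notin xs -> xi' x = xi x].
Proof.
move=> val [vs [eqs sub]]; rewrite /holds eval_subst => phiT.
exists (fun x => eval xi (bind xs (map (@value_term S M) vs) x)); split=> //.
- move=> x thx; have [xxs|xxs] := boolP (x \in xs); last first.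
    by rewrite bind_notin ?size_map //=; apply: val.
  have [_] := sub x; have [a ->] := bind_value_term eqs xxs.
  rewrite eval_value_term => <-.
  by have [_ _ /= ->] := val_sym_profile a.
- by move=> x xxs; rewrite bind_notin ?size_map.
Qed.

(** The values of [xi] itself are the witnesses. A valuation respects sorts only at theory sorts,
    hence the condition on [xs]. *)
Lemma valuation_ex_holds xi xs phi :
  is_valuation xi -> {in xs, forall x, theory_sort (var_sort x)} ->
  holds xi phi -> ex_holds xi xs phi.
Proof.
move=> val thxs phiT.
have bindE x : x \in xs ->
    bind xs (map (@value_term S M) (map xi xs)) x = value_term (xi x).
  move=> xxs; rewrite /bind -map_comp (nth_map x) ?index_mem //=.
  by rewrite nth_index.
exists (map xi xs); split; first by rewrite size_map.
  move=> x; have [xxs|xxs] := boolP (x \in xs); last first.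
    by rewrite bind_notin ?size_map.
  have [_ dom cod] := val_sym_profile (xi x).
  by rewrite bindE //= dom cod eqxx; split=> //; apply/val/thxs.
rewrite /holds eval_subst -phiT; apply: eq_in_eval => x _.
have [xxs|xxs] := boolP (x \in xs); first by rewrite bindE ?eval_value_term.
by rewrite bind_notin ?size_map.
Qed.

Lemma is_constraint_conj phi pi :
  is_constraint phi -> is_constraint pi -> is_constraint (conj M phi pi).
Proof.
move=> /and3P[w1 /eqP s1 t1] /and3P[w2 /eqP s2 t2].
have [th dom cod] := and_profile M.
by rewrite /is_constraint /= th dom cod s1 s2 w1 w2 t1 t2 !eqxx.
Qed.

Lemma holds_conj xi phi pi :
  holds xi phi -> holds xi pi -> holds xi (conj M phi pi).
Proof. by rewrite /holds /= => -> ->; rewrite andE. Qed.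

Lemma vars_conj phi pi : vars (conj M phi pi) = vars phi `|` vars pi.
Proof. by apply/fsetP=> x; rewrite in_fsetU !mem_vars /= cats0 mem_cat. Qed.

End Semantics.

Lemma is_constraint_var_sort (S : signature) (phi : term S) :
  is_constraint phi -> {in vars phi, forall x, theory_sort (var_sort x)}.
Proof.
case/and3P=> w /eqP s t x; rewrite mem_vars; apply: theory_term_var_sort => //.
by rewrite s bool_sort_theory.
Qed.

(** * Variables, sorts and models of the reduct and the instantiated guard *)

Section Redex.
Variables (S : signature) (M : model S) (rho : rule S) (T : ecterm S).
Variables (p : seq nat) (gamma : var S -> term S).
Hypotheses (rule_rho : is_rule rho) (ecT : is_ecterm T).
Hypothesis redex : has_redex M rho T p gamma.
Hypothesis disjoint_rho :
  rule_vars rho `&` (vars (body T) `|` vars (cond T)) = fset0.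

Let reduct := replace_at (body T) p (subst gamma (rhs rho)).
Let inst_guard := subst gamma (guard rho).

Lemma redex_subst_id x : x \notin vars (lhs rho) -> gamma x = Var x.
Proof.
have [_ dom _ _ _] := redex => xl.
(* Equality of terms need not be decidable, since [fsym] is a bare type; the shape of [gamma x] and
   equality of variables decide instead. *)
case E: (gamma x) => [y|f ts]; last first.
  by case/negP: xl; apply/dom; rewrite E.
have [->//|neq] := eqVneq y x.
by case/negP: xl; apply/dom; rewrite E => -[] /eqP; apply/negP.
Qed.

Lemma rule_vars_fresh x :
  x \in rule_vars rho -> (x \notin vars (body T)) && (x \notin vars (cond T)).
Proof.
move=> xr; rewrite -negb_or -in_fsetU; apply/negP => xT.
by have := in_fset0 x; rewrite -disjoint_rho in_fsetI xr xT.
Qed.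

Lemma redex_subst_vars_body x y :
  y \in vars (lhs rho) -> x \in vars (gamma y) -> x \in vars (body T).
Proof.
have [_ _ sub _ _] := redex; rewrite !mem_vars => yl xg.
apply: (var_occs_subterm_at sub); rewrite var_occs_subst.
by apply/flatten_mapP; exists y.
Qed.

(** Guard variables belong to [rvars rho], so redex condition (3) applies to them. *)
Lemma redex_subst_guard y : y \in vars (guard rho) -> y \in vars (lhs rho) ->
  is_value M (gamma y) \/ exists2 x, x \in lvars T & gamma y = Var x.
Proof.
move=> yg yl; have [_ _ _ val _] := redex; apply: val.
have [_ _ _ /fsubsetP Zsub _] := rule_rho.
by rewrite in_fsetI yl Zsub // in_fsetU yg orbT.
Qed.

(** On guard variables [gamma] yields only values and variables, so no term symbol enters the
    guard. *)
Lemma inst_guard_constraint : is_constraint inst_guard.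
Proof.
have [_ _ /and3P[wg /eqP sg tg] _ _] := rule_rho.
have [sub _ _ _ _] := redex.
rewrite /is_constraint well_sorted_subst // sort_of_subst // sg eqxx /=.
apply: theory_term_subst => // y; rewrite -mem_vars => yg.
have [yl|yl] := boolP (y \in vars (lhs rho)); last by rewrite redex_subst_id.
have [[a ->]|[x _ -> //]] := redex_subst_guard yg yl.
by rewrite /=; have [-> _ _] := val_sym_profile a.
Qed.

Lemma inst_guard_vars x : x \in vars inst_guard ->
  x \in lvars T \/ x \in vars (guard rho) `\` vars (lhs rho).
Proof.
rewrite mem_vars var_occs_subst => /flatten_mapP[y].
rewrite -!mem_vars => yg.
have [yl|yl] := boolP (y \in vars (lhs rho)); last first.
  rewrite redex_subst_id // mem_vars /= mem_seq1 => /eqP ->.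
  by right; rewrite in_fsetD yl.
have [[a ->]|[z zX ->]] := redex_subst_guard yg yl; rewrite mem_vars //=.
by rewrite mem_seq1 => /eqP ->; left.
Qed.

Lemma reduct_vars x : x \in vars reduct ->
  x \in vars (body T) \/ x \in ex_vars rho.
Proof.
have [_ _ sub _ _] := redex.
rewrite [x \in vars reduct]mem_vars => /(var_occs_replace_at sub).
rewrite -!mem_vars => /orP[]; first by left.
rewrite mem_vars var_occs_subst => /flatten_mapP[y]; rewrite -!mem_vars => yr.
have [yl|yl] := boolP (y \in vars (lhs rho)).
  by move=> xg; left; apply: redex_subst_vars_body xg.
rewrite redex_subst_id // mem_vars /= mem_seq1 => /eqP ->.
by right; rewrite in_fsetD yl.
Qed.

(** Extra variables are fixed by [gamma], so they survive in the instantiated right-hand side, which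
    is a subterm of the reduct. *)
Lemma ex_vars_reduct : ex_vars rho `<=` vars reduct.
Proof.
have [_ _ sub _ _] := redex.
apply/fsubsetP => x; rewrite in_fsetD !mem_vars => /andP[xl xr].
apply: (var_occs_replacement sub); rewrite var_occs_subst.
apply/flatten_mapP; exists x => //.
by rewrite redex_subst_id ?mem_vars //= mem_seq1.
Qed.

Lemma reduct_well_sorted : well_sorted reduct.
Proof.
have [sub _ subT _ _] := redex; have [wT _ _ _ _] := ecT.
have [[_ wr] slr _ _ _] := rule_rho.
have [] // := replace_at_well_sorted subT wT (well_sorted_subst sub wr).
by rewrite !sort_of_subst.
Qed.

(** A variable shared with the reduct is extra or already in [body T]. In the latter case it is not
    bound in [T], and it cannot be a rule variable, so it lies in [lvars T]. *)
Lemma reduct_ex_fvars x : x \in vars (conj M (cond T) inst_guard) ->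
  x \in vars reduct -> x \in ex_vars rho `|` (lvars T `&` vars reduct).
Proof.
have [_ _ /fsubsetP fvT _ disjT] := ecT.
rewrite vars_conj 2!in_fsetU in_fsetI => xcond xr.
rewrite xr andbT; have [xbT|-> //] := reduct_vars xr.
case/orP: xcond => [xc|/inst_guard_vars[->|]]; rewrite ?orbT //.
  rewrite fvT ?orbT // in_fsetD xc andbT; apply/negP => xb.
  by have := in_fset0 x; rewrite -disjT in_fsetI xb xbT.
rewrite in_fsetD => /andP[_ xg]; have /rule_vars_fresh : x \in rule_vars rho.
  by rewrite !in_fsetU xg !orbT.
by rewrite xbT.
Qed.

Lemma redex_satisfiable : ec_satisfiable M T ->
  exists2 xi : var S -> elt M,
    is_valuation xi & holds xi (conj M (cond T) inst_guard).
Proof.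
have [_ _ _ _ [zs [zsE entails]]] := redex.
have [_ _ _ /fsubsetP lvT disjT] := ecT.
case=> xi [val exT]; have exg := entails xi val exT.
have [xiT [valT holdsT outT]] := ex_holds_valuation val exT.
have [xig [valg holdsg outg]] := ex_holds_valuation val exg.
have mem_zs x : (x \in zs) = (x \in vars (guard rho) `\` vars (lhs rho)).
  by rewrite -zsE in_fset.
(* [xig] differs from the common valuation [xi] only on [zs], and [xiT] only on [bvars T]. *)
exists (fun x => if x \in zs then xig x else xiT x).
  by move=> x thx /=; case: ifP => _; [apply: valg | apply: valT].
apply: holds_conj.
  rewrite /holds -holdsT; apply: eq_in_eval => x; rewrite -mem_vars => xc.
  case: ifP => //; rewrite mem_zs in_fsetD => /andP[_ xg].
  have /rule_vars_fresh : x \in rule_vars rho by rewrite !in_fsetU xg !orbT.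
  by rewrite xc andbF.
(* Outside [zs], a variable of the instantiated guard lies in [lvars T], hence in [body T] and not
   in [bvars T]; there both models equal [xi]. *)
rewrite /holds -holdsg; apply: eq_in_eval => x; rewrite -mem_vars => xg.
case: ifP => // /negbT xzs; rewrite outg // outT //.
have [/lvT xbT|] := inst_guard_vars xg; last by rewrite -mem_zs (negbTE xzs).
apply/negP => xb; have := in_fset0 x.
by rewrite -disjT in_fsetI xbT in_fset xb.
Qed.

End Redex.

Theorem mainTheorem1 (S : signature) (M : model S) (rho : rule S)
    (T T' : ecterm S) :
  is_rule rho -> left_linear rho ->
  is_ecterm T -> ec_satisfiable M T ->
  rule_vars rho `&` (vars (body T) `|` vars (cond T)) = fset0 ->
  mg_step M rho T T' ->
  is_ecterm T' /\ ec_satisfiable M T'.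
Proof.
move=> rule_rho _ ecT satT disj [p [gamma [redex bodyE condE bvarsE lvarsE]]].
have [_ [constrT _] _ _ _] := ecT.
have constr' : is_constraint (cond T').
  by rewrite condE; apply: is_constraint_conj => //;
    apply: inst_guard_constraint rule_rho redex.
split; first split.
- by rewrite bodyE; apply: reduct_well_sorted rule_rho ecT redex.
- by split=> //; rewrite bvarsE fsubsetDl.
- apply/fsubsetP => x; rewrite /ex_fvars bvarsE !in_fsetD negb_and negbK.
  case/andP=> /orP[xb xc|/negbTE->] //.
  rewrite lvarsE bodyE; rewrite bodyE in xb; rewrite condE in xc.
  exact: reduct_ex_fvars rule_rho ecT redex disj x xc xb.
- rewrite lvarsE fsubUset fsubsetIr andbT bodyE.
  exact: ex_vars_reduct redex.
- apply/fsetP => x; rewrite bvarsE in_fsetI in_fsetD in_fset0.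
  by case: (x \in vars (body T')); rewrite ?andbF.
have [xi val] := redex_satisfiable rule_rho ecT redex disj satT.
rewrite -condE => holds'; exists xi; split=> //.
(* The glued model already satisfies the matrix; the new bound variables occur in a logical
   constraint, so they have theory sorts. *)
apply: valuation_ex_holds => // x xb.
apply: (is_constraint_var_sort constr').
suff : x \in [fset y in bvars T'] by rewrite bvarsE in_fsetD => /andP[].
by rewrite in_fset.
Qed.
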